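(* Let $A\in\mathbb{R}^{m\times n}$ have no zero rows, let $b\in\mathbb{R}^m$, $\widehat x\in\mathbb{R}^n$, $0<\delta<1$, and let $\varphi(p)=\frac12\|(\widehat x+A^{\rm T}p)_+\|^2-b^{\rm T}p$ for $p\in\mathbb{R}^m$. Assume $\varphi$ is bounded from below, and let $p_*$ be a minimizer of $\varphi$ on $\mathbb{R}^m$. Let $g(p)=A(\widehat x+A^{\rm T}p)_+-b$ be the gradient of $\varphi$, let $M(p)=A\,{\rm Diag}({\rm sign}((\widehat x+A^{\rm T}p)_+))A^{\rm T}+\delta\,{\rm Diag}(AA^{\rm T})$, and let $\gamma=\|\widehat A\|^2/\delta$, where $\widehat A=({\rm Diag}(AA^{\rm T}))^{-1/2}A$. Let $p_0\in\mathbb{R}^m$ and let $(p_k)_{k\ge0}$ be a sequence generated by the iteration $p_{k+1}=p_k-\alpha_kd_k$ where, writing $g_k=g(p_k)$ and $M_k=M(p_k)$, for every $k\ge 0$: (i) $d_k\in\mathbb{R}^m$ is a vector with $d_k^{\rm T}g_k=d_k^{\rm T}M_kd_k=\vartheta_k^2\,g_k^{\rm T}M_k^{-1}g_k$ for some $0<\vartheta_k<1$; (ii) $\alpha_k$ is the largest $\alpha\in\{1,1/2,1/4,\ldots\}$ such that $\varphi(p_k-\alpha d_k)\le\varphi(p_k)-\frac{\alpha}{2}d_k^{\rm T}g_k$. Then for every $k\ge0$, $$\varphi(p_{k+1})\le\varphi(p_k)-\frac{\vartheta_k^2}{4\gamma}\,g_k^{\rm T}M_k^{-1}g_k .$$ If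 moreover there is a constant $\vartheta_{\min}>0$ with $\vartheta_k^2\ge\vartheta_{\min}^2$ for all $k$, then for every $k\ge1$, $$\sum_{j=0}^{k-1}g_j^{\rm T}g_j\le\frac{4\gamma(1+\delta)\|A\|^2\,(\varphi(p_0)-\varphi(p_* ))}{\vartheta_{\min}^2},$$ and consequently $\lim_{k\to\infty}\|g(p_k)\|=0$.
   Context: For a real number $\xi$, $\xi_+=\max(0,\xi)$; for a vector, $(\cdot)_+$ and ${\rm sign}(\cdot)$ are applied componentwise, with ${\rm sign}(0)=0$. For a vector $v$, ${\rm Diag}(v)$ is the diagonal matrix with diagonal $v$; for a square matrix $B$, ${\rm Diag}(B)$ is the diagonal matrix having the same diagonal as $B$. $\|\cdot\|$ is the Euclidean norm for vectors and the spectral norm for matrices. *)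

(* Defs.v *)
From HB Require Import structures.
From mathcomp Require Import all_boot all_order all_algebra.
From mathcomp Require Import all_classical all_reals all_analysis.

Set Implicit Arguments.
Unset Strict Implicit.
Unset Printing Implicit Defensive.

Import Order.TTheory GRing.Theory Num.Theory.
Import numFieldNormedType.Exports.

Local Open Scope classical_set_scope.
Local Open Scope ring_scope.

Section EuclideanSpace.
Variable R : realType.

Definition dot m (u v : 'cV[R]_m) : R := (u^T *m v) 0 0.

(* The library norm `|v| on matrices is the maximum norm, hence enorm. *)
Definition enorm m (v : 'cV[R]_m) : R := Num.sqrt (dot v v).

(* The operator norm induced by enorm. *)
Definition spectral_norm m n (B : 'M[R]_(m, n)) : R :=
  sup [set enorm (B *m x) | x in [set x : 'cV[R]_n | enorm x <= 1]].

Definition pos_part n (v : 'cV[R]_n) : 'cV[R]_n := map_mx (Num.max 0) v.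

Definition sign_vec n (v : 'cV[R]_n) : 'cV[R]_n := map_mx Num.sg v.

Definition Diag_vec n (v : 'cV[R]_n) : 'M[R]_n := diag_mx v^T.

Definition Diag_mat n (B : 'M[R]_n) : 'M[R]_n := diag_mx (\row_i B i i).

End EuclideanSpace.

Section PiecewiseQuadratic.
Variables (R : realType) (m n : nat).
Variables (A : 'M[R]_(m, n)) (b : 'cV[R]_m) (xhat : 'cV[R]_n) (delta : R).

Definition phi (p : 'cV[R]_m) : R :=
  2^-1 * enorm (pos_part (xhat + A^T *m p)) ^+ 2 - dot b p.

(* The gradient of phi, by its explicit formula. *)
Definition grad_phi (p : 'cV[R]_m) : 'cV[R]_m :=
  A *m pos_part (xhat + A^T *m p) - b.

Definition newton_mx (p : 'cV[R]_m) : 'M[R]_m :=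
  A *m Diag_vec (sign_vec (pos_part (xhat + A^T *m p))) *m A^T
  + delta *: Diag_mat (A *m A^T).

(* (Diag (A A^T))^(-1/2) A; the diagonal entries of A A^T are positive as soon
   as A has no zero row. *)
Definition row_scaled : 'M[R]_(m, n) :=
  diag_mx (\row_i (Num.sqrt ((A *m A^T) i i))^-1) *m A.

Definition gamma : R := spectral_norm row_scaled ^+ 2 / delta.

Definition backtracking_steps (p d : 'cV[R]_m) : set R :=
  [set a | (exists j : nat, a = 2^-1 ^+ j) /\
           phi (p - a *: d) <= phi p - a / 2 * dot d (grad_phi p)].

Definition is_backtracking_step (p d : 'cV[R]_m) (a : R) : Prop :=
  backtracking_steps p d a /\ ubound (backtracking_steps p d) a.

End PiecewiseQuadratic.

(* Main.v *)
Require Import Defs.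
From HB Require Import structures.
From mathcomp Require Import all_boot all_order all_algebra.
From mathcomp Require Import all_classical all_reals all_analysis.
From mathcomp Require Import ring lra.

Import Order.TTheory GRing.Theory Num.Theory.
Import numFieldNormedType.Exports.

Local Open Scope classical_set_scope.
Local Open Scope ring_scope.

(** Since [(.)_+] is 1-Lipschitz, [phi (p - a d)] is at most
    [phi p - a d^T g + a^2/2 |A^T d|^2], and
    [|A^T d|^2 <= gamma d^T M d = gamma d^T g], because [M] dominates
    [delta Diag (A A^T)].  Hence every [a <= 1/gamma] passes the Armijo test,
    so the accepted step is 1 or exceeds [1/(2 gamma)]; as [gamma >= 1], either
    way the decrease is at least [d^T g / (4 gamma)].  Finally
    [M <= (1 + delta) |A|^2 I] gives
    [g^T g <= (1 + delta) |A|^2 g^T M^-1 g], and the decreases telescope. *)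

(** * The Euclidean inner product and norm *)

Lemma dotE {R : realType} {m : nat} (u v : 'cV[R]_m) :
  dot u v = \sum_i u i 0 * v i 0.
Proof. by rewrite /dot mxE; apply: eq_bigr => i _; rewrite mxE. Qed.

Lemma dotC {R : realType} {m : nat} (u v : 'cV[R]_m) : dot u v = dot v u.
Proof. by rewrite !dotE; apply: eq_bigr => i _; rewrite mulrC. Qed.

Lemma dotDr {R : realType} {m : nat} (u v w : 'cV[R]_m) :
  dot u (v + w) = dot u v + dot u w.
Proof. by rewrite /dot mulmxDr mxE. Qed.

Lemma dotDl {R : realType} {m : nat} (u v w : 'cV[R]_m) :
  dot (u + v) w = dot u w + dot v w.
Proof. by rewrite dotC dotDr !(dotC w). Qed.

Lemma dotZr {R : realType} {m : nat} (a : R) (u v : 'cV[R]_m) :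
  dot u (a *: v) = a * dot u v.
Proof. by rewrite /dot -scalemxAr mxE. Qed.

Lemma dotZl {R : realType} {m : nat} (a : R) (u v : 'cV[R]_m) :
  dot (a *: u) v = a * dot u v.
Proof. by rewrite dotC dotZr dotC. Qed.

Lemma dotNr {R : realType} {m : nat} (u v : 'cV[R]_m) :
  dot u (- v) = - dot u v.
Proof. by rewrite -scaleN1r dotZr mulN1r. Qed.

Lemma dot_mulmxr {R : realType} {m n : nat} (B : 'M[R]_(m, n))
    (u : 'cV[R]_m) (v : 'cV[R]_n) :
  dot u (B *m v) = dot (B^T *m u) v.
Proof. by rewrite /dot trmx_mul trmxK mulmxA. Qed.

Lemma dot_ge0 {R : realType} {m : nat} (u : 'cV[R]_m) : 0 <= dot u u.
Proof. by rewrite dotE; apply: sumr_ge0 => i _; rewrite -expr2 sqr_ge0. Qed.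

Lemma dot_eq0 {R : realType} {m : nat} (u : 'cV[R]_m) :
  (dot u u == 0) = (u == 0).
Proof.
apply/idP/eqP => [|->]; last by rewrite dotE big1 // => i _; rewrite !mxE mul0r.
rewrite dotE psumr_eq0 => [|i _]; last by rewrite -expr2 sqr_ge0.
move=> /allP u0; apply/colP => i; rewrite mxE.
by have /= := u0 i (mem_index_enum _); rewrite mulf_eq0 orbb => /eqP.
Qed.

(** Splits off the case [m = 0], where [gamma] is 0 and cannot be bounded below by 1; every inner
    product is then 0. *)
Lemma index_or_dot_eq0 {R : realType} {m : nat} (u v : 'cV[R]_m) :
  inhabited 'I_m \/ dot u v = 0.
Proof.
case: m u v => [|m] u v; last by left; exact: inhabits ord0.
by right; rewrite dotE big_ord0.
Qed.

Lemma enorm_ge0 {R : realType} {m : nat} (u : 'cV[R]_m) : 0 <= enorm u.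
Proof. exact: sqrtr_ge0. Qed.

Lemma enorm_sqr {R : realType} {m : nat} (u : 'cV[R]_m) :
  enorm u ^+ 2 = dot u u.
Proof. by rewrite sqr_sqrtr // dot_ge0. Qed.

Lemma enormZ {R : realType} {m : nat} (a : R) (u : 'cV[R]_m) :
  enorm (a *: u) = `|a| * enorm u.
Proof.
by rewrite /enorm dotZl dotZr mulrA -expr2 sqrtrM ?sqr_ge0 // sqrtr_sqr.
Qed.

(** * Cauchy-Schwarz inequalities *)

(** The form is nonnegative at every [s u - t v], and suitable [s], [t] yield the bound.
    Semidefiniteness suffices, so [v] may be isotropic. *)
Lemma psd_cauchy_schwarz {R : realType} {m : nat} (M : 'M[R]_m)
    (u v : 'cV[R]_m) :
  M^T = M -> (forall z, 0 <= dot z (M *m z)) ->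
  dot u (M *m v) ^+ 2 <= dot u (M *m u) * dot v (M *m v).
Proof.
move=> Msym Mge0.
have quad s t : 0 <= s ^+ 2 * dot u (M *m u) + t ^+ 2 * dot v (M *m v)
                     - 2 * s * t * dot u (M *m v).
  have -> : s ^+ 2 * dot u (M *m u) + t ^+ 2 * dot v (M *m v)
            - 2 * s * t * dot u (M *m v)
            = dot (s *: u + (- t) *: v) (M *m (s *: u + (- t) *: v)).
    have vu : dot v (M *m u) = dot u (M *m v) 
      by rewrite dotC [RHS]dot_mulmxr Msym.
    rewrite mulmxDr -!scalemxAr !dotDl !dotDr !dotZl !dotZr vu.
    by ring.
  exact: Mge0.
have a0 := Mge0 u; have c0 := Mge0 v.
move: (dot u (M *m v)) (dot u (M *m u)) (dot v (M *m v)) quad a0 c0 =>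
  b a c quad a0 c0.
have [c_gt0|c_le0] := ltP 0 c.
  (* The choice [(s, t) = (c, b)] gives [0 <= c (a c - b^2)]. *)
  rewrite -subr_ge0 -(pmulr_rge0 _ c_gt0).
  by have := quad c b; congr (_ <= _); ring.
have c_eq0 : c = 0 by apply/eqP; rewrite eq_le c_le0.
(* With [v] isotropic, the choice [(s, t) = (b, a + 1)] forces [b = 0]. *)
have : 0 <= - (b ^+ 2 * (a + 2)).
  by have := quad b (a + 1); congr (_ <= _); rewrite c_eq0; ring.
rewrite oppr_ge0 pmulr_lle0 ?c_eq0 ?mulr0 //.
by rewrite ltr_wpDl.
Qed.

Lemma cauchy_schwarz {R : realType} {m : nat} (u v : 'cV[R]_m) :
  dot u v ^+ 2 <= dot u u * dot v v.
Proof.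
have := @psd_cauchy_schwarz R m 1%:M u v; rewrite !mul1mx; apply.
  exact: trmx1.
by move=> z; rewrite mul1mx dot_ge0.
Qed.

Lemma dot_le_enorm {R : realType} {m : nat} (u v : 'cV[R]_m) :
  dot u v <= enorm u * enorm v.
Proof.
apply: le_trans (ler_norm _) _.
rewrite -(@ler_pXn2r _ 2) ?nnegrE ?mulr_ge0 ?enorm_ge0 ?normr_ge0 //.
by rewrite exprMn !enorm_sqr real_normK ?num_real ?cauchy_schwarz.
Qed.

(** * The spectral norm *)

(** Cauchy-Schwarz on each row bounds the set by the Frobenius norm, so that the [sup] in
    [spectral_norm] is a genuine supremum. *)
Lemma has_ubound_spectral_set {R : realType} {m n : nat} (B : 'M[R]_(m, n)) :
  has_ubound [set enorm (B *m x) | x in [set x : 'cV[R]_n | enorm x <= 1]].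
Proof.
pose F := \sum_i dot (row i B)^T (row i B)^T.
have F_ge0 : 0 <= F by apply: sumr_ge0 => i _; exact: dot_ge0.
exists (Num.sqrt F) => _ [x /= x_le1 <-]; rewrite ler_sqrt //.
have xx_le1 : dot x x <= 1 by rewrite -enorm_sqr expr_le1 ?enorm_ge0.
rewrite dotE; apply: ler_sum => i _.
have -> : (B *m x) i 0 = dot (row i B)^T x.
  by rewrite mxE dotE; apply: eq_bigr => j _; rewrite !mxE.
rewrite -expr2; apply: le_trans (cauchy_schwarz _ _) _.
by rewrite ler_piMr ?dot_ge0.
Qed.

Lemma spectral_norm_ge0 {R : realType} {m n : nat} (B : 'M[R]_(m, n)) :
  0 <= spectral_norm B.
Proof.
have e0 k : enorm (0 : 'cV[R]_k) = 0.
  by rewrite -(scale0r 0) enormZ normr0 mul0r.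
apply: ub_le_sup; first exact: has_ubound_spectral_set.
by exists 0; rewrite /= ?mulmx0 e0.
Qed.

Lemma enorm_mulmx_le {R : realType} {m n : nat} (B : 'M[R]_(m, n))
    (x : 'cV[R]_n) :
  enorm (B *m x) <= spectral_norm B * enorm x.
Proof.
have [-> | x_neq0] := eqVneq x 0.
  rewrite mulmx0 -(scale0r 0) enormZ normr0 mul0r.
  by rewrite mulr_ge0 ?spectral_norm_ge0 ?enorm_ge0.
have x_gt0 : 0 < enorm x by rewrite sqrtr_gt0 lt0r dot_eq0 x_neq0 dot_ge0.
have -> : enorm (B *m x) = enorm (B *m ((enorm x)^-1 *: x)) * enorm x.
  rewrite -scalemxAr enormZ ger0_norm ?invr_ge0 ?enorm_ge0 // mulrC mulrA.
  by rewrite mulfV ?gt_eqF // mul1r.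
rewrite ler_pM2r //; apply: ub_le_sup; first exact: has_ubound_spectral_set.
exists ((enorm x)^-1 *: x) => //=.
by rewrite enormZ ger0_norm ?invr_ge0 ?enorm_ge0 // mulVf ?gt_eqF.
Qed.

(** Transposition does not raise the norm: with [v = B^T u], [|v|^2 = u^T B v <= |u| |B| |v|], and
    [|v|] cancels. *)
Lemma dot_trmx_mulmx_le {R : realType} {m n : nat} (B : 'M[R]_(m, n))
    (u : 'cV[R]_m) :
  dot (B^T *m u) (B^T *m u) <= spectral_norm B ^+ 2 * dot u u.
Proof.
rewrite -!enorm_sqr -exprMn lerXn2r ?nnegrE ?mulr_ge0 ?spectral_norm_ge0
  ?enorm_ge0 //.
set v := B^T *m u.
have [v_gt0|v_le0] := ltP 0 (enorm v); last first.
  by apply: le_trans v_le0 _; rewrite mulr_ge0 ?spectral_norm_ge0 ?enorm_ge0.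
rewrite -(ler_pM2r v_gt0) -expr2 enorm_sqr {1}/v -dot_mulmxr.
apply: le_trans (dot_le_enorm _ _) _.
rewrite mulrAC mulrC ler_wpM2r ?enorm_ge0 //; exact: enorm_mulmx_le.
Qed.

(** * The diagonal of a Gram matrix *)

Lemma gram_diag {R : realType} {m n : nat} (B : 'M[R]_(m, n)) (i : 'I_m) :
  (B *m B^T) i i = dot (row i B)^T (row i B)^T.
Proof. by rewrite mxE dotE; apply: eq_bigr => j _; rewrite !mxE. Qed.

Lemma gram_diag_le {R : realType} {m n : nat} (B : 'M[R]_(m, n)) (i : 'I_m) :
  (B *m B^T) i i <= spectral_norm B ^+ 2.
Proof.
(* Row [i] of [B] is the image under [B^T] of a unit basis vector. *)
have := dot_trmx_mulmx_le B (delta_mx i 0).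
have -> : B^T *m delta_mx i 0 = (row i B)^T by rewrite -colE tr_row.
rewrite -gram_diag => /le_trans; apply.
by rewrite /dot trmx_delta mul_delta_mx mxE !eqxx mulr1.
Qed.

Lemma gram_diag_gt0 {R : realType} {m n : nat} (B : 'M[R]_(m, n)) (i : 'I_m) :
  row i B != 0 -> 0 < (B *m B^T) i i.
Proof. by rewrite gram_diag lt0r dot_ge0 dot_eq0 trmx_eq0 => ->. Qed.

Lemma dot_diag_mx {R : realType} {n : nat} (w : 'rV[R]_n) (v : 'cV[R]_n) :
  dot v (diag_mx w *m v) = \sum_i w 0 i * v i 0 ^+ 2.
Proof.
rewrite dotE; apply: eq_bigr => i _.
by rewrite mul_diag_mx mxE mulrCA expr2.
Qed.

Lemma dot_Diag_gram {R : realType} {m n : nat} (B : 'M[R]_(m, n))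
    (v : 'cV[R]_m) :
  dot v (Diag_mat (B *m B^T) *m v) = \sum_i (B *m B^T) i i * v i 0 ^+ 2.
Proof.
by rewrite dot_diag_mx; apply: eq_bigr => i _; rewrite [X in X * _]mxE.
Qed.

(** * The matrix with normalized rows *)

Section ScaledRows.
Context {R : realType} {m n : nat} {A : 'M[R]_(m, n)}.
Hypothesis rowA_neq0 : forall i, row i A != 0.

(** Undoing the scaling, [A^T d] is [row_scaled A] transposed applied to [r d], where [r] holds the
    row lengths, and [|r d|^2] is the diagonal form on the right. *)
Lemma dot_trmx_row_scaled_le (d : 'cV[R]_m) :
  dot (A^T *m d) (A^T *m d)
  <= spectral_norm (row_scaled A) ^+ 2 * dot d (Diag_mat (A *m A^T) *m d).
Proof.
pose r : 'rV[R]_m := \row_i Num.sqrt ((A *m A^T) i i).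
have DA : A = diag_mx r *m row_scaled A.
  apply/matrixP => i j; rewrite /row_scaled !mul_diag_mx [RHS]mxE.
  rewrite [r 0 i]mxE [X in _ * X]mxE [X in _ * (X * _)]mxE mulrA.
  by rewrite mulfV ?mul1r // gt_eqF ?sqrtr_gt0 ?gram_diag_gt0.
have -> : A^T *m d = (row_scaled A)^T *m (diag_mx r *m d).
  by rewrite {1}DA trmx_mul tr_diag_mx mulmxA.
apply: le_trans (dot_trmx_mulmx_le _ _) _.
rewrite ler_wpM2l ?sqr_ge0 // dot_Diag_gram dotE ler_sum // => i _.
rewrite -expr2 mul_diag_mx [X in X ^+ 2]mxE exprMn [r 0 i]mxE sqr_sqrtr //.
exact/ltW/gram_diag_gt0.
Qed.

(** Each scaled row has length 1, so the Gram matrix has unit diagonal. *)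
Lemma spectral_norm_row_scaled_ge1 (i : 'I_m) :
  1 <= spectral_norm (row_scaled A) ^+ 2.
Proof.
apply: le_trans (gram_diag_le _ i); rewrite gram_diag.
have D_gt0 := gram_diag_gt0 A i (rowA_neq0 i).
have -> : row i (row_scaled A)
          = (Num.sqrt ((A *m A^T) i i))^-1 *: row i A.
  by apply/rowP => j; rewrite /row_scaled mul_diag_mx !mxE.
rewrite linearZ dotZl dotZr -gram_diag mulrA -invfM -expr2.
rewrite sqr_sqrtr ?(ltW D_gt0) //.
by rewrite mulVf ?gt_eqF.
Qed.

End ScaledRows.

(** * The positive part and its sign pattern *)

(** The descent inequality for [max(0, s)^2], whose derivative [2 max(0, s)] is 2-Lipschitz. *)
Lemma sqr_pos_partD_le {R : realType} (s t : R) :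
  Num.max 0 (s + t) ^+ 2
  <= Num.max 0 s ^+ 2 + 2 * (t * Num.max 0 s) + t ^+ 2.
Proof. by case: (ltP 0 (s + t)) => ?; case: (ltP 0 s) => ?; nra. Qed.

Lemma dot_pos_partD_le {R : realType} {n : nat} (w v : 'cV[R]_n) :
  dot (pos_part (w + v)) (pos_part (w + v))
  <= dot (pos_part w) (pos_part w) + 2 * dot v (pos_part w) + dot v v.
Proof.
rewrite !dotE mulr_sumr -!big_split; apply: ler_sum => i _ /=.
by rewrite !mxE -!expr2 sqr_pos_partD_le.
Qed.

(** Signs of a nonnegative vector are 0 or 1, so the diagonal matrix lies between 0 and the
    identity. *)
Lemma dot_sign_pos_part {R : realType} {n : nat} (w v : 'cV[R]_n) :
  0 <= dot v (Diag_vec (sign_vec (pos_part w)) *m v) <= dot v v.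
Proof.
rewrite dot_diag_mx dotE; apply/andP; split.
  apply: sumr_ge0 => i _; rewrite !mxE mulr_ge0 ?sqr_ge0 //.
  by rewrite sgr_ge0 le_max lexx.
apply: ler_sum => i _; rewrite !mxE -expr2 ler_piMl ?sqr_ge0 //.
by case: sgrP.
Qed.

(** * Quadratic upper model of [phi] and spectral bounds for the Newton matrix *)

Section PiecewiseQuadraticTheory.
Context {R : realType} {m n : nat}.
Context {A : 'M[R]_(m, n)} {b : 'cV[R]_m} {xhat : 'cV[R]_n} {delta : R}.
Hypothesis rowA_neq0 : forall i, row i A != 0.
Hypothesis delta_gt0 : 0 < delta.

Local Notation phi := (phi A b xhat).
Local Notation grad_phi := (grad_phi A b xhat).
Local Notation newton_mx := (newton_mx A xhat delta).
Local Notation gamma := (gamma A delta).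

Lemma phi_descent (p h : 'cV[R]_m) :
  phi (p + h) <= phi p + dot h (grad_phi p) + 2^-1 * dot (A^T *m h) (A^T *m h).
Proof.
rewrite /Defs.phi /Defs.grad_phi !enorm_sqr mulmxDr addrA dotDr.
rewrite [dot h (_ - _)]dotDr dotNr.
rewrite dot_mulmxr (dotC h b).
have := dot_pos_partD_le (xhat + A^T *m p) (A^T *m h).
by move: (dot (pos_part _) _) (dot (pos_part _) _) => x y; lra.
Qed.

Lemma trmx_newton_mx (p : 'cV[R]_m) : (newton_mx p)^T = newton_mx p.
Proof.
by rewrite linearD linearZ /= !trmx_mul trmxK !tr_diag_mx mulmxA.
Qed.

Lemma dot_newton_mx (p z : 'cV[R]_m) :
  dot z (newton_mx p *m z)
  = dot (A^T *m z)
      (Diag_vec (sign_vec (pos_part (xhat + A^T *m p))) *m (A^T *m z))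
    + delta * dot z (Diag_mat (A *m A^T) *m z).
Proof.
by rewrite mulmxDl dotDr -scalemxAl dotZr -!mulmxA dot_mulmxr.
Qed.

Lemma dot_newton_mx_ge (p z : 'cV[R]_m) :
  delta * dot z (Diag_mat (A *m A^T) *m z) <= dot z (newton_mx p *m z).
Proof.
rewrite dot_newton_mx lerDr.
by case/andP: (dot_sign_pos_part (xhat + A^T *m p) (A^T *m z)).
Qed.

Lemma dot_Diag_gram_ge0 (z : 'cV[R]_m) : 0 <= dot z (Diag_mat (A *m A^T) *m z).
Proof.
rewrite dot_Diag_gram; apply: sumr_ge0 => i _.
by rewrite mulr_ge0 ?sqr_ge0 // ltW ?gram_diag_gt0.
Qed.

Lemma dot_newton_mx_ge0 (p z : 'cV[R]_m) : 0 <= dot z (newton_mx p *m z).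
Proof.
apply: le_trans (dot_newton_mx_ge p z).
by rewrite mulr_ge0 ?dot_Diag_gram_ge0 ?ltW.
Qed.

(** A kernel vector annihilates the form of [Diag (A A^T)], whose weights are positive, so it is
    0. *)
Lemma newton_mx_unit (p : 'cV[R]_m) : newton_mx p \in unitmx.
Proof.
rewrite -row_free_unit; apply: inj_row_free => v vM0.
have Mv0 : newton_mx p *m v^T = 0.
  by rewrite -trmx_newton_mx -trmx_mul vM0 trmx0.
have : dot v^T (Diag_mat (A *m A^T) *m v^T) = 0.
  apply/eqP; rewrite eq_le dot_Diag_gram_ge0 andbT -(pmulr_rle0 _ delta_gt0).
  by apply: le_trans (dot_newton_mx_ge p _) _; rewrite Mv0 /dot mulmx0 mxE.
rewrite dot_Diag_gram => /eqP; rewrite psumr_eq0 => [/allP v0|i _]; last first.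
  by rewrite mulr_ge0 ?sqr_ge0 // ltW ?gram_diag_gt0.
apply/rowP => i; have /= := v0 i (mem_index_enum _).
by rewrite mulf_eq0 gt_eqF ?gram_diag_gt0 //= sqrf_eq0 !mxE => /eqP.
Qed.

(** The sign part contributes at most [|A^T z|^2 <= |A|^2 |z|^2]; the diagonal part has entries at
    most [delta |A|^2]. *)
Lemma dot_newton_mx_le (p z : 'cV[R]_m) :
  dot z (newton_mx p *m z) <= (1 + delta) * spectral_norm A ^+ 2 * dot z z.
Proof.
rewrite dot_newton_mx -mulrA mulrDl mul1r lerD //.
  case/andP: (dot_sign_pos_part (xhat + A^T *m p) (A^T *m z)) =>
    _ /le_trans; apply.
  exact: dot_trmx_mulmx_le.
rewrite ler_pM2l // dot_Diag_gram dotE mulr_sumr ler_sum // => i _.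
by rewrite -expr2 ler_wpM2r ?sqr_ge0 ?gram_diag_le.
Qed.

Lemma dot_invmx_newton_ge0 (p g : 'cV[R]_m) :
  0 <= dot g (invmx (newton_mx p) *m g).
Proof.
(* With [y = M^-1 g], the quantity is [y^T M y]. *)
have := dot_newton_mx_ge0 p (invmx (newton_mx p) *m g).
by rewrite mulKVmx ?newton_mx_unit // dotC.
Qed.

(* Cauchy-Schwarz for the form [z^T M z], applied to [y] and [M y] where
   [M y = g]. *)
Lemma dot_le_dot_invmx_newton (p g : 'cV[R]_m) :
  dot g g <= (1 + delta) * spectral_norm A ^+ 2
             * dot g (invmx (newton_mx p) *m g).
Proof.
set M := newton_mx p; set y := invmx M *m g.
have My : M *m y = g by rewrite mulKVmx ?newton_mx_unit.
have yMy : dot y (M *m y) = dot g y by rewrite My dotC.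
have gy_ge0 : 0 <= dot g y by exact: dot_invmx_newton_ge0.
have c_ge0 : 0 <= (1 + delta) * spectral_norm A ^+ 2.
  by rewrite mulr_ge0 ?sqr_ge0 // addr_ge0 // ltW.
have [gg_gt0|gg_le0] := ltP 0 (dot g g); last first.
  by apply: le_trans gg_le0 _; rewrite mulr_ge0.
have := psd_cauchy_schwarz M g y (trmx_newton_mx p) (dot_newton_mx_ge0 p).
rewrite -/M yMy My => cs.
(* [cs] bounds [(g^T g)^2] by [(g^T M g)(g^T y)], and [g^T M g] is at most
   [(1 + delta) |A|^2 g^T g]. *)
rewrite -(ler_pM2l gg_gt0) -expr2; apply: le_trans cs _.
by rewrite mulrCA mulrA ler_wpM2r // dot_newton_mx_le.
Qed.

Lemma dot_trmx_le_newton (p d : 'cV[R]_m) :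
  dot (A^T *m d) (A^T *m d) <= gamma * dot d (newton_mx p *m d).
Proof.
apply: le_trans (dot_trmx_row_scaled_le rowA_neq0 d) _.
rewrite /Defs.gamma -mulrA ler_wpM2l ?sqr_ge0 // -(ler_pM2l delta_gt0).
by rewrite mulVKf ?gt_eqF ?dot_newton_mx_ge.
Qed.

(** * The backtracking line search *)

Lemma phi_step (p d : 'cV[R]_m) (a : R) :
  dot d (grad_phi p) = dot d (newton_mx p *m d) ->
  phi (p - a *: d)
  <= phi p - a * dot d (grad_phi p)
     + 2^-1 * (a ^+ 2 * (gamma * dot d (grad_phi p))).
Proof.
move=> dg; rewrite -scaleNr; apply: le_trans (phi_descent _ _) _.
rewrite dotZl mulNr lerD2l -scalemxAr dotZl dotZr mulrA mulrNN -expr2.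
by rewrite !ler_wpM2l ?sqr_ge0 ?invr_ge0 ?ler0n // dg dot_trmx_le_newton.
Qed.

(** The index [i] ensures that [A] has a row. *)
Lemma gamma_ge1 (i : 'I_m) : delta < 1 -> 1 <= gamma.
Proof.
move=> delta_lt1; rewrite ler_pdivlMr // mul1r (le_trans (ltW delta_lt1)) //.
exact: spectral_norm_row_scaled_ge1.
Qed.

(* If [a < 1] then [2 a] was rejected, which [phi_step] only allows when
   [1 < 2 a gamma]. *)
Lemma backtracking_step_decrease (p d : 'cV[R]_m) (a : R) :
  delta < 1 ->
  dot d (grad_phi p) = dot d (newton_mx p *m d) ->
  is_backtracking_step A b xhat p d a ->
  phi (p - a *: d) <= phi p - (4 * gamma)^-1 * dot d (grad_phi p).
Proof.
move=> delta_lt1 dg [[[j aE] armijo] amax].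
apply: le_trans armijo _; rewrite lerD2l lerN2.
have dg_ge0 : 0 <= dot d (grad_phi p) by rewrite dg dot_newton_mx_ge0.
have [[i]|->] := index_or_dot_eq0 d (grad_phi p); last by rewrite !mulr0.
have gamma_ge1 := gamma_ge1 i delta_lt1.
have gamma_gt0 : 0 < gamma by apply: lt_le_trans gamma_ge1.
apply: ler_wpM2r => //.
have gamma4_gt0 : 0 < 4 * gamma by rewrite pmulr_rgt0.
rewrite -div1r ler_pdivrMr //.
(* A full step [a = 1] only needs [1 <= 2 gamma]. *)
case: j aE => [|j] aE; first by rewrite aE expr0; lra.
have a_gt0 : 0 < a by rewrite aE exprn_gt0 ?invr_gt0.
have dblE : 2 * a = 2^-1 ^+ j by rewrite aE exprS mulrA mulfV ?mul1r.
have [//|small] := leP 1 (a / 2 * (4 * gamma)).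
(* If [2 a gamma < 1], then [2 a] passes the test too, contradicting the maximality of [a]. *)
have : 2 * a <= a; last by lra.
apply: amax; split; first by exists j.
apply: le_trans (phi_step p d (2 * a) dg) _.
move: (dot _ _) dg_ge0 => x x_ge0; rewrite -addrA lerD2l.
(* Separates the Armijo decrease for step [2 a] from a remainder whose sign is that of
   [1 - 2 a gamma]. *)
have -> : - (2 * a * x) + 2^-1 * ((2 * a) ^+ 2 * (gamma * x))
        = - (2 * a / 2 * x) - a * x * (1 - 2 * a * gamma).
  by field.
rewrite gerBl; apply: mulr_ge0; last by lra.
by rewrite mulr_ge0 // ltW.
Qed.

End PiecewiseQuadraticTheory.

(** * Per-step decrease, telescoping and convergence of the gradients *)

Theorem mainTheorem1 (R : realType) (m n : nat)
    (A : 'M[R]_(m, n)) (b : 'cV[R]_m) (xhat : 'cV[R]_n) (delta : R)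
    (pstar : 'cV[R]_m) (p d : nat -> 'cV[R]_m) (alpha theta : nat -> R)
    (hA : forall i : 'I_m, row i A != 0)
    (hdelta : 0 < delta < 1)
    (hbounded : has_lbound (range (phi A b xhat)))
    (hpstar : forall q : 'cV[R]_m, phi A b xhat pstar <= phi A b xhat q)
    (hp : forall k : nat, p k.+1 = p k - alpha k *: d k)
    (htheta : forall k : nat, 0 < theta k < 1)
    (hd : forall k : nat,
        let g_k := grad_phi A b xhat (p k) in
        let M_k := newton_mx A xhat delta (p k) in
        dot (d k) g_k = dot (d k) (M_k *m d k) /\
        dot (d k) (M_k *m d k) = theta k ^+ 2 * dot g_k (invmx M_k *m g_k))
    (halpha : forall k : nat,
        is_backtracking_step A b xhat (p k) (d k) (alpha k)) :
  (forall k : nat,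
      let g_k := grad_phi A b xhat (p k) in
      let M_k := newton_mx A xhat delta (p k) in
      phi A b xhat (p k.+1) <=
        phi A b xhat (p k)
        - theta k ^+ 2 / (4 * gamma A delta) * dot g_k (invmx M_k *m g_k)) /\
  (forall theta_min : R, 0 < theta_min ->
      (forall k : nat, theta_min ^+ 2 <= theta k ^+ 2) ->
      (forall k : nat, (1 <= k)%N ->
          \sum_(0 <= j < k)
             dot (grad_phi A b xhat (p j)) (grad_phi A b xhat (p j)) <=
          4 * gamma A delta * (1 + delta) * spectral_norm A ^+ 2
            * (phi A b xhat (p 0%N) - phi A b xhat pstar) / theta_min ^+ 2) /\
      enorm (grad_phi A b xhat (p k)) @[k --> \oo] --> (0 : R)).
Proof.
case/andP: hdelta => delta_gt0 delta_lt1.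
have decrease k : phi A b xhat (p k.+1) <=
    phi A b xhat (p k) - theta k ^+ 2 / (4 * gamma A delta) *
      dot (grad_phi A b xhat (p k))
        (invmx (newton_mx A xhat delta (p k)) *m grad_phi A b xhat (p k)).
  have [dg dMd] := hd k; rewrite hp mulrAC -dMd -dg mulrC.
  exact: (backtracking_step_decrease hA).
split=> // theta_min theta_min_gt0 theta_min_le.
set K := 4 * gamma A delta * (1 + delta) * spectral_norm A ^+ 2
           / theta_min ^+ 2.
have gamma_ge0 : 0 <= gamma A delta.
  exact: divr_ge0 (sqr_ge0 _) (ltW delta_gt0).
have c_ge0 : 0 <= (1 + delta) * spectral_norm A ^+ 2.
  by rewrite mulr_ge0 ?sqr_ge0 // addr_ge0 // ltW.
have gamma4_ge0 : 0 <= 4 * gamma A delta by exact: mulr_ge0.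
have K_ge0 : 0 <= K.
  by apply: divr_ge0 (sqr_ge0 _); rewrite -mulrA; exact: mulr_ge0.
(* Each squared gradient is paid for by the decrease of [phi] at its own step, which makes the sum
   telescope. *)
have grad_le j : dot (grad_phi A b xhat (p j)) (grad_phi A b xhat (p j))
    <= K * (phi A b xhat (p j) - phi A b xhat (p j.+1)).
  set g := grad_phi A b xhat (p j).
  have q_ge0 := dot_invmx_newton_ge0 (xhat := xhat) hA delta_gt0 (p j) g.
  have gg_le := dot_le_dot_invmx_newton (xhat := xhat) hA delta_gt0 (p j) g.
  have := decrease j; rewrite -/g.
  move: (dot g (invmx _ *m _)) q_ge0 gg_le => q q_ge0 gg_le dec.
  have dec_ge0 : 0 <= phi A b xhat (p j) - phi A b xhat (p j.+1).
    rewrite subr_ge0; apply: le_trans dec _; rewrite gerBl.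
    exact: mulr_ge0 (divr_ge0 (sqr_ge0 _) gamma4_ge0) q_ge0.
  (* With no index the left side is 0 and [dec_ge0] suffices; otherwise [gamma > 0] may be divided
     out. *)
  have [[i]|->] := index_or_dot_eq0 g g; last exact: mulr_ge0.
  have gamma_gt0 : 0 < gamma A delta.
    exact: lt_le_trans ltr01 (gamma_ge1 hA delta_gt0 i delta_lt1).
  apply: le_trans gg_le _.
  have -> : K = (1 + delta) * spectral_norm A ^+ 2
                * (4 * gamma A delta / theta_min ^+ 2) by rewrite /K; ring.
  rewrite -[leRHS]mulrA ler_wpM2l // mulrAC ler_pdivlMr ?exprn_gt0 //.
  (* What remains is [theta_min^2 q <= theta_j^2 q <= 4 gamma] times the decrease. *)
  apply: le_trans (ler_wpM2l q_ge0 (theta_min_le j)) _.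
  have gamma4_gt0 : 0 < 4 * gamma A delta by exact: mulr_gt0.
  rewrite [leLHS]mulrC -ler_pdivrMl // mulrA [_^-1 * _]mulrC.
  by rewrite lerBrDr -lerBrDl.
have sum_le k :
    \sum_(0 <= j < k) dot (grad_phi A b xhat (p j)) (grad_phi A b xhat (p j))
    <= K * (phi A b xhat (p 0%N) - phi A b xhat pstar).
  apply: (@le_trans _ _ (K * (phi A b xhat (p 0%N) - phi A b xhat (p k)))).
    rewrite -[X in K * X]opprB.
    rewrite -(telescope_sumr (fun j => phi A b xhat (p j)) (leq0n k)).
    by rewrite -sumrN mulr_sumr; apply: ler_sum => j _; rewrite opprB.
  (* Minimality of [pstar] replaces [phi (p k)] by a bound independent of [k]. *)
  by rewrite ler_wpM2l // lerD2l lerN2.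
split=> [k _|]; first by apply: le_trans (sum_le k) _; rewrite /K mulrAC.
have sqr_cvg0 : (dot (grad_phi A b xhat (p k)) (grad_phi A b xhat (p k)))
    @[k --> \oo] --> (0 : R).
  (* The partial sums are nondecreasing and bounded by [sum_le], so the series converges and its
     terms tend to 0. *)
  apply: cvg_series_cvg_0; apply: nondecreasing_is_cvgn.
    apply/nondecreasing_seqP => k; rewrite !seriesEnat /= big_nat_recr //=.
    by rewrite lerDl dot_ge0.
  by exists (K * (phi A b xhat (p 0%N) - phi A b xhat pstar)) =>
    _ [k _ <-]; exact: sum_le.
(* Continuity of the square root at 0 passes from squared norms to norms. *)
rewrite -[X in _ --> X]sqrtr0.
exact: (cvg_comp _ _ sqr_cvg0 (@sqrt_continuous R 0)).
Qed.
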